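(* Let $\mathbf{A}\in\mathbb{C}^{m\times n}$ and let $\mathbf{y}\in\mathbb{C}^{1\times n}$ be a row vector. Consider the system of linear equations $\mathbf{x}\mathbf{A}=\mathbf{y}$ in the unknown row vector $\mathbf{x}\in\mathbb{C}^{1\times m}$, and put $\mathbf{g}=\mathbf{y}\mathbf{A}^{*}$. Let $\mathbf{x}^{0}=\mathbf{y}\mathbf{A}^{+}=(x^{0}_{1},\dots,x^{0}_{m})$ be its least squares solution. (i) If $\operatorname{rank}\mathbf{A}=m$, then $$x^{0}_{i}=\frac{\det(\mathbf{A}\mathbf{A}^{*})_{i\,.}(\mathbf{g})}{\det\mathbf{A}\mathbf{A}^{*}}\qquad\text{for all } i=1,\dots,m.$$ (ii) If $\operatorname{rank}\mathbf{A}=r\le n<m$ with $r\ge1$, then $$x^{0}_{i}=\frac{\displaystyle\sum_{\alpha\in I_{r,m}\{i\}}\left|\left((\mathbf{A}\mathbf{A}^{*})_{i\,.}(\mathbf{g})\right)^{\alpha}_{\alpha}\right|}{d_{r}(\mathbf{A}\mathbf{A}^{*})}\qquad\text{for all } i=1,\dots,m.$$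
   Context: $\mathbf{A}^{*}$ is the conjugate transpose of $\mathbf{A}$. $\mathbf{A}^{+}\in\mathbb{C}^{n\times m}$ is the Moore–Penrose inverse, the unique matrix with $\mathbf{A}\mathbf{A}^{+}\mathbf{A}=\mathbf{A}$, $\mathbf{A}^{+}\mathbf{A}\mathbf{A}^{+}=\mathbf{A}^{+}$, $(\mathbf{A}\mathbf{A}^{+})^{*}=\mathbf{A}\mathbf{A}^{+}$, $(\mathbf{A}^{+}\mathbf{A})^{*}=\mathbf{A}^{+}\mathbf{A}$. The least squares solution of $\mathbf{x}\mathbf{A}=\mathbf{y}$ is the minimizer of $\|\mathbf{x}\mathbf{A}-\mathbf{y}\|$ (Euclidean norm) of minimal Euclidean norm, which is $\mathbf{y}\mathbf{A}^{+}$. $\mathbf{B}_{i\,.}(\mathbf{b})$ is the matrix obtained from $\mathbf{B}$ by replacing its $i$th row by the row vector $\mathbf{b}$. For $1\le r\le m$, $I_{r,m}$ is the set of all strictly increasing sequences of $r$ integers chosen from $\{1,\dots,m\}$, and $I_{r,m}\{i\}$ is the set of those $\alpha\in I_{r,m}$ containing $i$. $|\mathbf{B}^{\alpha}_{\alpha}|$ is the principal minor of the square matrix $\mathbf{B}$ with rows and columns indexed by $\alpha$. $d_{r}(\mathbf{A}\mathbf{A}^{*})=\sum_{\alpha\in I_{r,m}}|(\mathbf{A}\mathbf{A}^{*})^{\alpha}_{\alpha}|$. *)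

(* Defs.v *)
From HB Require Import structures.
From mathcomp Require Import all_boot all_order all_algebra.
From mathcomp Require Import reals complex.

Set Implicit Arguments.
Unset Strict Implicit.
Unset Printing Implicit Defensive.

Import Order.TTheory GRing.Theory Num.Theory.

Local Open Scope ring_scope.
Local Open Scope sesquilinear_scope.
Local Open Scope complex_scope.

Section MoorePenrose.
Variable C : numClosedFieldType.

Definition moore_penrose m n (A : 'M[C]_(m, n)) (X : 'M[C]_(n, m)) : bool :=
  [&& A *m X *m A == A, X *m A *m X == X,
      (A *m X)^t* == A *m X & (X *m A)^t* == X *m A].

Lemma trmxC_mul m n p (A : 'M[C]_(m, n)) (B : 'M[C]_(n, p)) :
  (A *m B)^t* = B^t* *m A^t*.
Proof. by rewrite trmx_mul map_mxM. Qed.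

Lemma gram_unit m n (A : 'M[C]_(m, n)) :
  row_free A -> A *m A^t* \in unitmx.
Proof.
move=> Afree; rewrite -row_free_unit -kermx_eq0; apply/eqP/row_matrixP => i.
have : row i (kermx (A *m A^t*)) *m (A *m A^t*) = 0.
  by apply/sub_kermxP; rewrite row_sub.
move: (row i _) => v vK; rewrite row0; apply/eqP.
have vA0 : dotmx (v *m A) (v *m A) = 0.
  by rewrite dotmxE trmxC_mul mulmxA -[v *m A *m _]mulmxA vK mul0mx mxE.
by rewrite -(mulmx_free_eq0 v Afree) -(dnorm_eq0 (@dotmx C n)) [X in X == _]vA0.
Qed.

Lemma moore_penrose_exists m n (A : 'M[C]_(m, n)) :
  exists X, moore_penrose A X.
Proof.
have := row_base_free A; have := col_base_full A; move: (mulmx_base A).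
move: (col_base A) (row_base A); move: (\rank A) => k F G <- Ffull Gfree.
have Gu : G *m G^t* \in unitmx by exact: gram_unit.
have Fu : F^t* *m F \in unitmx.
  have /gram_unit : row_free (F^t*) by rewrite /row_free mxrank_map mxrank_tr.
  by rewrite trmxCK.
pose P := G^t* *m invmx (G *m G^t*); pose Q := invmx (F^t* *m F) *m F^t*.
have GP : G *m P = 1%:M by rewrite mulmxA mulmxV.
have QF : Q *m F = 1%:M by rewrite -mulmxA mulVmx.
have Hinv (M : 'M[C]_k) : M^t* = M -> (invmx M)^t* = invmx M.
  by move=> HM; rewrite trmx_inv map_invmx HM.
have AX : F *m G *m (P *m Q) = F *m Q.
  by rewrite -mulmxA [G *m _]mulmxA GP mul1mx.
have XA : P *m Q *m (F *m G) = P *m G.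
  by rewrite -mulmxA [Q *m _]mulmxA QF mul1mx.
exists (P *m Q); rewrite /moore_penrose XA AX; apply/and4P; split; apply/eqP.
- by rewrite -mulmxA [Q *m _]mulmxA QF mul1mx.
- by rewrite -mulmxA [G *m _]mulmxA GP mul1mx.
- rewrite /Q !trmxC_mul trmxCK Hinv ?mulmxA //.
  by rewrite trmxC_mul trmxCK.
- rewrite /P !trmxC_mul trmxCK Hinv ?mulmxA //.
  by rewrite trmxC_mul trmxCK.
Qed.

Lemma moore_penrose_unique m n (A : 'M[C]_(m, n)) (X Y : 'M[C]_(n, m)) :
  moore_penrose A X -> moore_penrose A Y -> X = Y.
Proof.
move=> /and4P[/eqP X1 /eqP X2 /eqP X3 /eqP X4].
move=> /and4P[/eqP Y1 /eqP Y2 /eqP Y3 /eqP Y4].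
have AXY : A *m X = A *m Y.
  by rewrite -[LHS]X3 -{1}Y1 -mulmxA trmxC_mul X3 Y3 mulmxA X1.
have XYA : X *m A = Y *m A.
  by rewrite -[LHS]X4 -{1}Y1 -mulmxA mulmxA trmxC_mul X4 Y4 -mulmxA
             [A *m _]mulmxA X1.
by rewrite -X2 XYA -mulmxA AXY mulmxA Y2.
Qed.

Definition mpinv m n (A : 'M[C]_(m, n)) : 'M[C]_(n, m) :=
  xchoose (moore_penrose_exists A).

Lemma mpinvP m n (A : 'M[C]_(m, n)) : moore_penrose A (mpinv A).
Proof. exact: xchooseP. Qed.

End MoorePenrose.

Section LeastSquares.
Variable C : numClosedFieldType.

(* Valued in C, whose order is only partial; both sides of every comparison
   of norms are nonnegative reals. *)
Definition enorm n (v : 'rV[C]_n) : C := sqrtC (\sum_j `|v 0 j| ^+ 2).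

Definition lsq_minimizer m n (A : 'M[C]_(m, n)) (y : 'rV[C]_n)
    (x : 'rV[C]_m) : Prop :=
  forall z : 'rV[C]_m, enorm (x *m A - y) <= enorm (z *m A - y).

Definition lsq_solution m n (A : 'M[C]_(m, n)) (y : 'rV[C]_n)
    (x : 'rV[C]_m) : Prop :=
  lsq_minimizer A y x /\
  forall z : 'rV[C]_m, lsq_minimizer A y z -> enorm x <= enorm z.

End LeastSquares.

Definition replace_row (T : Type) m n (B : 'M[T]_(m, n)) (i : 'I_m)
    (b : 'rV[T]_n) : 'M[T]_(m, n) :=
  \matrix_(k, j) if k == i then b 0 j else B k j.

Definition incr_seqs (r m : nat) : {set r.-tuple 'I_m} :=
  [set alpha : r.-tuple 'I_m | sorted ltn (map val alpha)].

Definition incr_seqs_at (r m : nat) (i : 'I_m) : {set r.-tuple 'I_m} :=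
  [set alpha in incr_seqs r m | i \in alpha].

Definition principal_minor (K : comPzRingType) r m (B : 'M[K]_m)
    (alpha : r.-tuple 'I_m) : K :=
  \det (mxsub (tnth alpha) (tnth alpha) B).

Definition sum_principal_minors (K : comPzRingType) (r m : nat)
    (B : 'M[K]_m) : K :=
  \sum_(alpha in incr_seqs r m) principal_minor B alpha.

(* Main.v *)
Require Import Defs.
From HB Require Import structures.
From mathcomp Require Import all_boot all_order all_algebra.
From mathcomp Require Import reals complex.

Set Implicit Arguments.
Unset Strict Implicit.
Unset Printing Implicit Defensive.

Import Order.TTheory GRing.Theory Num.Theory.

Local Open Scope ring_scope.
Local Open Scope sesquilinear_scope.
Local Open Scope complex_scope.

(** Write [B = A *m A^t*], [g = y *m A^t*] and [x0 = y *m mpinv A]. The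
    Penrose equations say that [A *m mpinv A] and [mpinv A *m A] are Hermitian,
    and this yields [x0 *m B = g] and that [x0] is in the row space of [A^t*].

    The first fact is the normal equation: the residual [x0 *m A - y] is
    orthogonal to the row space of [A]. By Pythagoras the minimizers of the
    norm of [z *m A - y] are the [z] with [(z - x0) *m A = 0]; the second fact
    makes such a [z - x0] orthogonal to [x0], so that [x0] is the only one of
    least norm ([lsq_solution_mpinv]).

    For [A] of full row rank, [B] is invertible and Cramer's rule applies to
    [x0 *m B = g]. For rank [r], factor [B = U *m V] through dimension [r] with
    [V *m U] invertible ([adjoint_rank_factorization]). Comparing coefficients
    in Sylvester's identity
    ['X^r * det ('X + U *m V) = 'X^m * det ('X + V *m U)] shows that the
    principal minors of order [r] of [U *m V] add up to [det (V *m U)]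
    ([sum_principal_minors_mul]). The minors whose index set contains [i] are
    isolated by subtracting the same sum for the matrix whose row [i] is zero.
    Changing row [i] of [U *m V] within the row space of [V] only changes row
    [i] of [U], hence changes [V *m U] by a matrix of rank one, whose effect on
    the determinant is explicit. As [x0 = w *m V] for some [w], the difference
    of the two sums is [x0 0 i * det (V *m U)] ([cramer_rank_factorization]). *)

(** * Determinants of products and of rank-one updates *)

(** Sylvester's determinant identity; both sides are
    [a ^+ r * \det (block_mx a%:M (- U) V 1%:M)], computed by eliminating
    either of the off-diagonal blocks. *)
Lemma det_scalar_addC (K : comPzRingType) m r (U : 'M[K]_(m, r))
    (V : 'M[K]_(r, m)) (a : K) :
  a ^+ r * \det (a%:M + U *m V) = a ^+ m * \det (a%:M + V *m U).
Proof.
pose M := block_mx a%:M (- U) V (1%:M : 'M_r).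
have elim_V : \det M = \det (a%:M + U *m V).
  have := det_mulmx M (block_mx 1%:M 0 (- V) 1%:M).
  rewrite mulmx_block !mulmx0 !mulmx1 mul1mx !add0r mulNmx mulmxN opprK subrr.
  by rewrite det_ublock det_lblock !det1 !mulr1.
have elim_U : \det M * a ^+ r = a ^+ m * \det (a%:M + V *m U).
  have := det_mulmx M (block_mx 1%:M U 0 a%:M).
  rewrite mulmx_block !mulmx0 !mulmx1 mul1mx !addr0 mulNmx.
  rewrite mul_scalar_mx mul_mx_scalar subrr det_lblock det_ublock.
  by rewrite !det_scalar expr1n mul1r [V *m U + _]addrC => ->.
by rewrite -elim_U elim_V mulrC.
Qed.

Lemma det1_addC (K : comPzRingType) m r (U : 'M[K]_(m, r))
    (V : 'M[K]_(r, m)) :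
  \det (1%:M + U *m V) = \det (1%:M + V *m U).
Proof. by have := det_scalar_addC U V 1; rewrite !expr1n !mul1r. Qed.

(** The matrix determinant lemma, by factoring [W] out on the left and
    turning [1 + column * row] into a scalar with [det1_addC]. *)
Lemma det_rank1_update (K : comUnitRingType) n (W : 'M[K]_n) (c : 'cV[K]_n)
    (p : 'rV[K]_n) :
  W \in unitmx ->
  \det (W + c *m p) = \det W * (1 + (p *m invmx W *m c) 0 0).
Proof.
move=> Wu; rewrite -[X in _ + X](mulKVmx Wu) -{1}[W]mulmx1 -mulmxDr.
by rewrite det_mulmx mulmxA det1_addC mulmxA [\det (_ + _)]det_mx11 !mxE.
Qed.

Lemma replace_rowE (K : pzRingType) m n (B : 'M[K]_(m, n)) (i : 'I_m)
    (b : 'rV[K]_n) :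
  replace_row B i b = B + delta_mx i 0 *m (b - row i B).
Proof.
apply/matrixP=> k j; rewrite !mxE big_ord1 !mxE eqxx andbT.
by case: eqP => [->|_]; rewrite ?mul1r ?mul0r ?addr0 // addrC subrK.
Qed.

Lemma replace_row_mul (K : pzRingType) m n p (U : 'M[K]_(m, n))
    (V : 'M[K]_(n, p)) (i : 'I_m) (u : 'rV[K]_n) :
  replace_row (U *m V) i (u *m V) = replace_row U i u *m V.
Proof. by rewrite !replace_rowE mulmxDl -mulmxA mulmxBl row_mul. Qed.

(** Cramer's rule in the form without division: replacing row [i] of [B] by
    [x *m B] amounts to multiplying [B] on the left by the identity matrix with
    row [i] replaced by [x], and that factor has determinant [x 0 i]. *)
Lemma det_replace_row_mul (K : comPzRingType) m (B : 'M[K]_m) (i : 'I_m)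
    (x : 'rV[K]_m) :
  \det (replace_row B i (x *m B)) = x 0 i * \det B.
Proof.
rewrite -[B in replace_row B]mul1mx replace_row_mul det_mulmx; congr (_ * _).
rewrite replace_rowE det1_addC [\det _]det_mx11 mulmxBl -!colE !mxE !eqxx.
by rewrite addrC subrK.
Qed.

(** * Sums of principal minors *)

(** The principal minor of [B] on an index set [J], as a determinant of the
    size of [B]: the rows outside [J] are those of the identity matrix, so
    that no enumeration of [J] is involved. *)
Definition set_minor (K : comPzRingType) m (B : 'M[K]_m) (J : {set 'I_m}) : K :=
  \det (\matrix_(i, j) if i \in J then B i j else (i == j)%:R).

(** With [E] the matrix that selects the rows in [alpha], [set_minor] is
    [\det (1 + E^T *m (E *m (B - 1)))], and moving [E^T] to the other side by
    [det1_addC] leaves the submatrix of [B] on [alpha]. *)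
Lemma principal_minor_set (K : comPzRingType) r m (B : 'M[K]_m)
    (alpha : r.-tuple 'I_m) :
  uniq alpha -> principal_minor B alpha = set_minor B [set i in alpha].
Proof.
move=> /tuple_uniqP alpha_inj.
pose E : 'M[K]_(r, m) := rowsub (tnth alpha) 1%:M.
have EM k (M : 'M[K]_(m, k)) : E *m M = rowsub (tnth alpha) M.
  by rewrite -rowsubE.
have -> : set_minor B [set i in alpha] = \det (1%:M + E^T *m (E *m (B - 1%:M))).
  congr (\det _); apply/matrixP=> i j; rewrite EM !mxE inE.
  case: ifPn => [/tnthP[k ->]|i_alpha].
    rewrite (bigD1 k) //= big1 ?addr0 => [|l lk]; last first.
      by rewrite !mxE (inj_eq alpha_inj) (negPf lk) mul0r.
    by rewrite !mxE eqxx mul1r addrC subrK.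
  rewrite big1 ?addr0 // => l _; rewrite !mxE.
  by case: eqP i_alpha => [<-|]; rewrite ?mem_tnth ?mul0r.
rewrite det1_addC EM; congr (\det _); apply/matrixP=> k l; rewrite !mxE.
rewrite (bigD1 (tnth alpha l)) //= big1 ?addr0 => [|j jl]; last first.
  by rewrite !mxE [_ l == j]eq_sym (negPf jl) mulr0.
by rewrite !mxE eqxx mulr1 (inj_eq alpha_inj) addrC subrK.
Qed.

Lemma incr_seqs_uniq r m (alpha : r.-tuple 'I_m) :
  alpha \in incr_seqs r m -> uniq alpha.
Proof.
rewrite inE => /(sorted_uniq ltn_trans ltnn).
by rewrite (map_inj_uniq val_inj).
Qed.

Lemma incr_seqs_set_inj r m :
  {in incr_seqs r m &, injective (fun alpha => [set i in alpha])}.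
Proof.
move=> a b; rewrite !inE => a_incr b_incr /setP ab.
apply/val_inj/(inj_map val_inj).
apply: (irr_sorted_eq ltn_trans ltnn) => //.
by apply: eq_mem_map => i; have := ab i; rewrite !inE.
Qed.

(** One inclusion is clear, and both sides have ['C(m, r)] elements. *)
Lemma incr_seqs_sets r m :
  [set [set i in alpha] | alpha : r.-tuple 'I_m in incr_seqs r m]
    = [set J : {set 'I_m} | #|J| == r].
Proof.
apply/eqP; rewrite eqEcard card_draws card_ord; apply/andP; split.
  apply/subsetP=> _ /imsetP[alpha alpha_incr ->]; rewrite inE cardsE.
  by rewrite (card_uniqP (incr_seqs_uniq alpha_incr)) size_tuple.
by rewrite (card_in_imset (@incr_seqs_set_inj r m)) card_ltn_sorted_tuples.
Qed.

Lemma sum_principal_minors_set (K : comPzRingType) r m (B : 'M[K]_m) :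
  sum_principal_minors r B = \sum_(J : {set 'I_m} | #|J| == r) set_minor B J.
Proof.
transitivity (\sum_(J in [set J : {set 'I_m} | #|J| == r]) set_minor B J).
  rewrite -incr_seqs_sets (big_imset _ (@incr_seqs_set_inj r m)).
  by apply: eq_bigr => alpha /incr_seqs_uniq; apply: principal_minor_set.
by apply: eq_bigl => J; rewrite inE.
Qed.

(** Expanding each row of ['X%:M + B] as the sum of a row of ['X%:M] and a row
    of [B]; the set [J] collects the rows taken from [B]. *)
Lemma det_addX_set (K : comNzRingType) m (B : 'M[K]_m) :
  \det ('X%:M + map_mx polyC B) =
    \sum_(J : {set 'I_m}) 'X^(m - #|J|) * (set_minor B J)%:P.
Proof.
pose rowsX (J : {set 'I_m}) := \row_i (if i \in J then 1 else 'X : {poly K}).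
pose minor_mx (J : {set 'I_m}) :=
  \matrix_(i, j) if i \in J then B i j else (i == j)%:R.
have split_rows (J : {set 'I_m}) (i j : 'I_m) :
    (diag_mx (rowsX J) *m map_mx polyC (minor_mx J)) i j =
      if i \in J then (B i j)%:P else 'X *+ (i == j).
  rewrite mul_diag_mx !mxE; case: ifP => _; first by rewrite mul1r.
  by rewrite polyC_natr mulr_natr.
transitivity (\sum_(J : {set 'I_m})
    \det (diag_mx (rowsX J) *m map_mx polyC (minor_mx J))).
  rewrite exchange_big; apply: eq_bigr => s _; rewrite -big_distrr /=.
  congr (_ * _); under eq_bigr do rewrite !mxE addrC.
  rewrite bigA_distr; apply: eq_bigr => J _; apply: eq_bigr => i _.
  by rewrite split_rows.
apply: eq_bigr => J _; rewrite det_mulmx det_map_mx det_diag; congr (_ * _).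
have -> : (m - #|J| = #|~: J|)%N by rewrite [RHS]cardsCs setCK card_ord.
rewrite -prodr_const [RHS]big_mkcond.
by apply: eq_bigr => i _; rewrite mxE inE; case: (i \in J).
Qed.

(** The factor ['X^r] makes the identity hold for [r > m] as well, where both
    sides vanish, and turns [m - r] into an index without subtraction. *)
Lemma coef_det_addX (K : comNzRingType) r m (B : 'M[K]_m) :
  ('X^r * \det ('X%:M + map_mx polyC B))`_m = sum_principal_minors r B.
Proof.
rewrite det_addX_set sum_principal_minors_set big_distrr /= coef_sum.
rewrite [RHS]big_mkcond.
apply: eq_bigr => J _; rewrite mulrA -exprD coefMC coefXn.
have Jm : (#|J| <= m)%N by rewrite -[m in (_ <= m)%N]card_ord max_card.
have -> : (m == r + (m - #|J|))%N = (#|J| == r).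
  by rewrite -{1}(subnKC Jm) eqn_add2r.
by case: ifP; rewrite ?mul1r ?mul0r.
Qed.

(** The Cauchy-Binet sum over the principal minors of order [r], read off the
    two sides of Sylvester's identity: the coefficient of ['X^m] in
    ['X^m * \det ('X%:M + V *m U)] is [\det (V *m U)]. *)
Lemma sum_principal_minors_mul (K : comNzRingType) m r (U : 'M[K]_(m, r))
    (V : 'M[K]_(r, m)) :
  sum_principal_minors r (U *m V) = \det (V *m U).
Proof.
rewrite -coef_det_addX map_mxM det_scalar_addC -map_mxM coefXnM ltnn subnn.
rewrite -horner_coef0 -horner_evalE -det_map_mx; congr (\det _).
apply/matrixP=> i j; rewrite !mxE /= horner_evalE.
by rewrite hornerD hornerC hornerMn hornerX mul0rn add0r.
Qed.

(** The minors on the index sets avoiding [i] do not see row [i], and those on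
    the other index sets vanish when that row is zero. *)
Lemma sum_principal_minors_at (K : comPzRingType) r m (B : 'M[K]_m)
    (i : 'I_m) (b : 'rV[K]_m) :
  \sum_(alpha in incr_seqs_at r i) principal_minor (replace_row B i b) alpha
    = sum_principal_minors r (replace_row B i b)
      - sum_principal_minors r (replace_row B i 0).
Proof.
rewrite -sumrB [RHS](bigID (fun alpha => i \in alpha)) /= [X in _ = _ + X]big1.
  rewrite addr0; apply: eq_big => [alpha|alpha]; first by rewrite inE.
  rewrite inE => /andP[_ i_alpha].
  rewrite [X in _ = _ - X](_ : _ = 0) ?subr0 //.
  have /tnthP[k ik] := i_alpha; rewrite /principal_minor (expand_det_row _ k).
  by apply: big1 => l _; rewrite !mxE -ik eqxx mul0r.
move=> alpha /andP[_ i_alpha]; apply/eqP; rewrite subr_eq0; apply/eqP.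
congr (\det _); apply/matrixP=> k l; rewrite !mxE.
by case: eqP i_alpha => // <-; rewrite mem_tnth.
Qed.

(** Row [i] of [U *m V] is replaced by [(w *m (V *m U)) *m V], so both
    determinants given by [sum_principal_minors_at] and
    [sum_principal_minors_mul] are rank-one updates of [\det (V *m U)], and
    they differ by [\det (V *m U) * (w *m col i V)]. *)
Lemma cramer_rank_factorization (K : fieldType) m r (U : 'M[K]_(m, r))
    (V : 'M[K]_(r, m)) (w : 'rV[K]_r) (i : 'I_m) :
  V *m U \in unitmx ->
  \sum_(alpha in incr_seqs_at r i)
     principal_minor (replace_row (U *m V) i (w *m V *m (U *m V))) alpha
    = (w *m V) 0 i * sum_principal_minors r (U *m V).
Proof.
move=> Wu; rewrite sum_principal_minors_at.
have minors_replace (u : 'rV[K]_r) :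
    sum_principal_minors r (replace_row (U *m V) i (u *m V)) =
      \det (V *m U + col i V *m (u - row i U)).
  rewrite replace_row_mul sum_principal_minors_mul replace_rowE mulmxDr.
  by rewrite mulmxA -colE.
rewrite -(mul0mx 1 V) mulmxA -[w *m V *m U]mulmxA !minors_replace.
rewrite !det_rank1_update // sum_principal_minors_mul -mulrBr mulrC.
congr (_ * _); rewrite !mulmxBl !mul0mx mulmxK //
  [w *m col i V](_ : _ = col i (w *m V)) ?colE ?mulmxA // -colE !mxE.
by rewrite sub0r opprD opprK addrACA subrr add0r subrK.
Qed.

(** * Least squares solutions *)

Section LeastSquaresSolution.
Variables (C : numClosedFieldType) (m n : nat) (A : 'M[C]_(m, n)).
Variable y : 'rV[C]_n.
Implicit Types x z : 'rV[C]_m.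

Lemma enorm_le k (u v : 'rV[C]_k) :
  (enorm u <= enorm v) = (dotmx u u <= dotmx v v).
Proof.
have sq (w : 'rV[C]_k) : \sum_j `|w 0 j| ^+ 2 = dotmx w w.
  by rewrite dotmxE mxE; apply: eq_bigr => j _; rewrite !mxE normCK.
by rewrite /enorm !sq ler_sqrtC // qualifE /= dnorm_ge0.
Qed.

(** The adjoint of [A *m (mpinv A *m A) = A], the second factor being
    Hermitian. *)
Lemma mpinv_mul_adjoint : mpinv A *m (A *m A^t*) = A^t*.
Proof.
have /and4P[/eqP AXA _ _ /eqP XA] := mpinvP A.
by rewrite mulmxA -XA -trmxC_mul mulmxA AXA.
Qed.

Lemma mpinv_sub_adjoint : mpinv A = mpinv A *m (mpinv A)^t* *m A^t*.
Proof.
have /and4P[_ /eqP XAX /eqP AX _] := mpinvP A.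
by rewrite -mulmxA -trmxC_mul AX mulmxA XAX.
Qed.

(** The normal equations: [mpinv_mul_adjoint] shows that the residual
    [y *m mpinv A *m A - y] is killed by [A^t*]. *)
Lemma residual_mpinv_orthogonal z :
  dotmx (z *m A) (y *m mpinv A *m A - y) = 0.
Proof.
have resA : (y *m mpinv A *m A - y) *m A^t* = 0.
  by rewrite mulmxBl -!mulmxA mpinv_mul_adjoint subrr.
rewrite dotmxE -mulmxA -[A in z *m (A *m _)]trmxCK -trmxC_mul resA.
by rewrite trmx0 map_mx0 mulmx0 mxE.
Qed.

(** [y *m mpinv A] lies in the row space of [A^t*], the orthogonal complement
    of the solutions of [z *m A = 0]. *)
Lemma mpinv_kernel_orthogonal z : z *m A = 0 -> dotmx z (y *m mpinv A) = 0.
Proof.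
move=> zA; rewrite mpinv_sub_adjoint [y *m _]mulmxA dotmxE trmxC_mul trmxCK.
by rewrite mulmxA zA mul0mx mxE.
Qed.

Lemma residual_pythagoras z :
  dotmx (z *m A - y) (z *m A - y) =
    dotmx ((z - y *m mpinv A) *m A) ((z - y *m mpinv A) *m A)
    + dotmx (y *m mpinv A *m A - y) (y *m mpinv A *m A - y).
Proof.
rewrite -(hnormDd (residual_mpinv_orthogonal _)).
by rewrite mulmxBl addrA subrK.
Qed.

Lemma lsq_minimizer_mpinv z :
  lsq_minimizer A y z <-> (z - y *m mpinv A) *m A = 0.
Proof.
split=> [/(_ (y *m mpinv A))|zA x]; last first.
  have -> : z *m A = y *m mpinv A *m A by apply/subr0_eq; rewrite -mulmxBl.
  by rewrite enorm_le [leRHS]residual_pythagoras lerDr dnorm_ge0.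
rewrite enorm_le residual_pythagoras -[leRHS]add0r lerD2r => zA_le0.
by apply/eqP; rewrite -(dnorm_eq0 (@dotmx C n)) eq_le zA_le0 dnorm_ge0.
Qed.

Lemma lsq_solution_mpinv z : lsq_solution A y z <-> z = y *m mpinv A.
Proof.
have pythagoras x : lsq_minimizer A y x -> dotmx x x =
    dotmx (x - y *m mpinv A) (x - y *m mpinv A)
    + dotmx (y *m mpinv A) (y *m mpinv A).
  by move/lsq_minimizer_mpinv/mpinv_kernel_orthogonal/hnormDd <-; rewrite subrK.
have mpinv_min : lsq_minimizer A y (y *m mpinv A).
  by apply/lsq_minimizer_mpinv; rewrite subrr mul0mx.
split=> [[z_min /(_ _ mpinv_min)]|->]; last first.
  by split=> // x /pythagoras xE; rewrite enorm_le xE lerDr dnorm_ge0.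
rewrite enorm_le (pythagoras _ z_min) -[leRHS]add0r lerD2r => z_le0.
by apply/eqP; rewrite -subr_eq0 -(dnorm_eq0 (@dotmx C m)) eq_le z_le0 dnorm_ge0.
Qed.

(** * Cramer's rule for the Moore-Penrose inverse *)

Lemma mpinv_cramer_full_rank (i : 'I_m) :
  \rank A = m ->
  (y *m mpinv A) 0 i =
    \det (replace_row (A *m A^t*) i (y *m A^t*)) / \det (A *m A^t*).
Proof.
move=> Am; have Bu : A *m A^t* \in unitmx by apply/gram_unit/eqP.
rewrite -{2}mpinv_mul_adjoint mulmxA det_replace_row_mul mulfK //.
by rewrite -unitfE -unitmxE.
Qed.

(** From a full rank factorization [A = F *m G], [U = F] and
    [V = G *m G^t* *m F^t*] will do: [V *m U] is the product of the Gram
    matrices of [G] and [F^t*], both invertible. *)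
Lemma adjoint_rank_factorization :
  exists (U : 'M[C]_(m, \rank A)) (V : 'M[C]_(\rank A, m)),
    [/\ A *m A^t* = U *m V, V *m U \in unitmx & (A^t* <= V)%MS].
Proof.
have := row_base_free A; have := col_base_full A; have := mulmx_base A.
move: (col_base A) (row_base A) => F G AE Ffull Gfree.
have Gu : G *m G^t* \in unitmx by exact: gram_unit.
have Fu : F^t* *m F \in unitmx.
  have /gram_unit : row_free (F^t*) by rewrite /row_free mxrank_map mxrank_tr.
  by rewrite trmxCK.
have AtE : A^t* = G^t* *m F^t* by rewrite -trmxC_mul AE.
exists F, (G *m G^t* *m F^t*); split.
- by rewrite AtE -{1}AE !mulmxA.
- by rewrite -[X in X \in _]mulmxA unitmx_mul Gu.
- apply/submxP; exists (G^t* *m invmx (G *m G^t*)).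
  by rewrite AtE mulmxA mulmxKV.
Qed.

Lemma mpinv_cramer_rank (i : 'I_m) :
  (y *m mpinv A) 0 i =
    (\sum_(alpha in incr_seqs_at (\rank A) i)
       principal_minor (replace_row (A *m A^t*) i (y *m A^t*)) alpha)
    / sum_principal_minors (\rank A) (A *m A^t*).
Proof.
have [U [V [BE VUu AV]]] := adjoint_rank_factorization.
have /submxP[w x0E] : (y *m mpinv A <= V)%MS.
  by rewrite mpinv_sub_adjoint mulmxA (submx_trans _ AV) // submxMl.
rewrite -{2}mpinv_mul_adjoint mulmxA x0E BE cramer_rank_factorization //.
by rewrite sum_principal_minors_mul mulfK // -unitfE -unitmxE.
Qed.

End LeastSquaresSolution.

Theorem theorem4p3 (R : realType) (m n : nat) (A : 'M[R[i]]_(m, n))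
    (y : 'rV[R[i]]_n) :
  let g : 'rV[R[i]]_m := y *m A^t* in
  let x0 : 'rV[R[i]]_m := y *m mpinv A in
  [/\ (forall x : 'rV[R[i]]_m, lsq_solution A y x <-> x = x0),
      (\rank A = m ->
       forall i : 'I_m,
         x0 0 i = \det (replace_row (A *m A^t*) i g) / \det (A *m A^t*))
    & (forall r : nat,
       \rank A = r -> (r <= n)%N -> (n < m)%N -> (1 <= r)%N ->
       forall i : 'I_m,
         x0 0 i =
           (\sum_(alpha in incr_seqs_at r i)
              principal_minor (replace_row (A *m A^t*) i g) alpha)
           / sum_principal_minors r (A *m A^t*))].
Proof.
split=> [x|Am i|r Ar _ _ _ i]; first exact: lsq_solution_mpinv.
  exact: mpinv_cramer_full_rank.
by rewrite -Ar; apply: mpinv_cramer_rank.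
Qed.
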